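(* Let $\mathcal{P}$ be a property of convex sets in $\mathbb{R}^d$. If $\mathcal{P}$ is Helly, monotone and orderable, then $\mathcal{P}$ is $h(\mathcal{P})$-colorable.
   Context: A property $\mathcal{P}$ is a function from the set of convex sets in $\mathbb{R}^d$ to $\{\text{true},\text{false}\}$; we say $\mathcal{P}(K)$ when its value on $K$ is true. The Helly number $h(\mathcal{P})$ is the smallest positive integer $h$ such that for every $m\in\mathbb{N}$ and all convex sets $F_1,\dots,F_m\subset\mathbb{R}^d$: if $\mathcal{P}(F_{i_1}\cap\cdots\cap F_{i_h})$ is true for all $i_1,\dots,i_h\in\{1,\dots,m\}$, then $\mathcal{P}(F_1\cap\cdots\cap F_m)$ is true. If no such $h$ exists, $h(\mathcal{P}):=\infty$. The property $\mathcal{P}$ is called: 1. Helly, if $h(\mathcal{P})$ is finite. 2. Monotone, if whenever $K\subset K'$ are convex and $\mathcal{P}(K)$ is true, then $\mathcal{P}(K')$ is true. 3. Orderable, if for every finite family $\mathcal{F}$ of convex sets in $\mathbb{R}^d$ there is a direction $v\in\mathbb{R}^d\setminus\{0\}$ such that for every $K\in\mathcal{F}$ with $\mathcal{P}(K)$ true: (a) there is a containment-minimal $v$-semispace $H$ (a $v$-semispace being a half-space of the form $\{x\in\mathbb{R}^d: v^Tx\ge c\}$ with $c\in\mathbb{R}$) such that $\mathcal{P}(K\cap H)$ is true; and (b) for this $H$ there is a unique (containment-)minimal convex set $K'\subset K\cap H$ with $\mathcal{P}(K')$ true. 4. $N$-colorable (for a positive integer $N$), if for all finite nonempty families $\mathcal{F}_1,\dots,\mathcal{F}_N$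 of closed convex sets in $\mathbb{R}^d$ (the color classes) such that $\mathcal{P}(K_1\cap\cdots\cap K_N)$ is true for every rainbow choice $K_1\in\mathcal{F}_1,\dots,K_N\in\mathcal{F}_N$, there is an index $i$ such that $\mathcal{P}(\bigcap\mathcal{F}_i)$ is true. *)

(* Defs.v *)
From HB Require Import structures.
From mathcomp Require Import all_boot all_order all_algebra.
From mathcomp Require Import all_classical all_reals all_analysis.

Set Implicit Arguments.
Unset Strict Implicit.
Unset Printing Implicit Defensive.

Import Order.TTheory GRing.Theory Num.Theory.
Import numFieldNormedType.Exports.

Local Open Scope classical_set_scope.
Local Open Scope ring_scope.

(* The library's [convex_set] is stated on the alias [convex_lmodType M]. *)
Definition convex_subset (R : realType) (d : nat) (K : set 'cV[R]_d) : Prop :=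
  convex_set (M := 'cV[R]_d) K.

(* A property is a function on convex sets only. It is represented by a
   predicate on all sets, and everything below evaluates it at convex sets
   only, so its values at other sets are irrelevant. *)
Definition property (R : realType) (d : nat) := set 'cV[R]_d -> Prop.

Definition containment_minimal (T : Type) (Q : set T -> Prop) (A : set T) : Prop :=
  Q A /\ forall B : set T, Q B -> B `<=` A -> B = A.

Section Properties.
Variables (R : realType) (d : nat).
Implicit Types (P : property R d) (K H : set 'cV[R]_d).

(* The families F_1, ..., F_m are nonempty, and the indices i_1, ..., i_h
   may repeat. *)
Definition helly_at P (h : nat) : Prop :=
  (0 < h)%N /\
  forall (m : nat) (F : 'I_m -> set 'cV[R]_d),
    (0 < m)%N ->
    (forall j, convex_subset (F j)) ->
    (forall i : 'I_h -> 'I_m, P (\bigcap_k F (i k))) ->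
    P (\bigcap_j F j).

Lemma helly_at_asbool P :
  (exists h, helly_at P h) -> exists h, `[< helly_at P h >].
Proof. by case=> h Ph; exists h; apply/asboolP. Qed.

(* [None] stands for an infinite Helly number. *)
Definition helly_number P : option nat :=
  if pselect (exists h, helly_at P h) is left ex_h
  then Some (ex_minn (helly_at_asbool ex_h)) else None.

Lemma helly_numberP P (h : nat) :
  helly_number P = Some h <->
  helly_at P h /\ forall h', helly_at P h' -> (h <= h')%N.
Proof.
rewrite /helly_number; case: pselect => [ex_h|nex_h]; last first.
  by split=> [//|[Ph _]]; case: nex_h; exists h.
case: ex_minnP => n /asboolP Pn n_min; split=> [[<-]|[Ph h_min]].
  by split=> // h' Ph'; apply: n_min; apply/asboolP.
congr Some; apply/eqP; rewrite eqn_leq h_min // andbT.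
by apply: n_min; apply/asboolP.
Qed.

Definition helly P : Prop := exists h, helly_number P = Some h.

Definition monotone_property P : Prop :=
  forall K K', convex_subset K -> convex_subset K' -> K `<=` K' -> P K -> P K'.

Definition semispace (v : 'cV[R]_d) H : Prop :=
  exists c : R, H = [set x | c <= (v^T *m x) 0 0].

Definition orderable P : Prop :=
  forall F : set (set 'cV[R]_d),
    finite_set F ->
    (forall K, F K -> convex_subset K) ->
    exists2 v : 'cV[R]_d, v != 0 &
      forall K, F K -> P K ->
        exists2 H,
          containment_minimal (fun H => semispace v H /\ P (K `&` H)) H &
          exists! K',
            containment_minimal
              (fun C => [/\ convex_subset C, C `<=` K `&` H & P C]) K'.

Definition colorable (N : nat) P : Prop :=
  forall F : 'I_N -> set (set 'cV[R]_d),
    (forall i, finite_set (F i)) ->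
    (forall i, F i !=set0) ->
    (forall i K, F i K -> closed K /\ convex_subset K) ->
    (forall K : 'I_N -> set 'cV[R]_d,
       (forall i, F i (K i)) -> P (\bigcap_i K i)) ->
    exists i, P (\bigcap_(K in F i) K).

End Properties.

(* Main.v *)
Require Import Defs.
From mathcomp Require Import all_boot all_order all_algebra.
From mathcomp Require Import all_classical all_reals all_analysis.

Set Implicit Arguments.
Unset Strict Implicit.
Unset Printing Implicit Defensive.

Import Order.TTheory GRing.Theory Num.Theory.

Local Open Scope classical_set_scope.
Local Open Scope ring_scope.

(** The proof adapts Lovasz's argument for the colorful Helly theorem, with the
    minimal semispaces of orderability in place of lexicographic minima.

    Let [h] be the Helly number. For a rainbow choice [K] and a color [j], let
    [skip j K] be the intersection of the [K i] with [i <> j]. All the sets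
    [skip j K] and all full rainbow intersections have the property and there
    are finitely many, so orderability gives one direction [v] for all of them,
    and each has a smallest [v]-semispace in which the property persists. Take
    the set [A = skip j K] whose smallest semispace [H] is the largest
    ([rainbow_largest_semispace]). Then every [skip j' K'] keeps the property
    when cut by [H], and Helly's condition for the [h + 1] sets made of a
    rainbow choice and [H] shows that every full rainbow intersection keeps it
    too ([helly_cut]).

    For [L] in the class [j], the set [A `&` L] thus keeps the property inside
    [H], and its smallest semispace is again [H], because shrinking it would
    shrink that of [A] ([minimal_semispace_subset]). Hence a minimal set inside
    [A `&` L `&` H] is also minimal inside [A `&` H], and by uniqueness it is
    the set [M] attached to [A] ([unique_minimal_subset]). So [M] lies in every
    member of the class [j], hence in their intersection, which has the property
    by monotonicity. *)

(** * Finiteness *)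

Lemma finite_set_choices (I : finType) (T : choiceType) (F : I -> set T) :
  (forall i, finite_set (F i)) ->
  finite_set [set K : I -> T | forall i, F i (K i)].
Proof.
move=> finF.
have /finite_seqP[s sE] : finite_set (\bigcup_i F i).
  by apply: bigcup_finite => // i _; exact: finF.
pose toK (g : {ffun I -> seq_sub s}) i := ssval (g i).
apply: (@sub_finite_set _ _ (toK @` setT)); last exact: finite_image.
move=> K FK.
have Ks i : K i \in s.
  suff: [set` s] (K i) by [].
  by rewrite -sE; exists i.
exists [ffun i => SeqSub (Ks i)] => //.
by apply/funext => i; rewrite /toK ffunE.
Qed.

Lemma finite_set_argmin (d : Order.disp_t) (R : orderType d) (T : Type)
    (A : set T) (f : T -> R) :
  finite_set A -> A !=set0 ->
  exists2 a, A a & forall b, A b -> (f a <= f b)%O.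
Proof.
move=> /(finite_image f)/finite_seqP[s sE] [a0 Aa0].
have in_s b : A b -> f b \in s.
  by move=> Ab; suff: [set` s] (f b) by []; rewrite -sE; exists b.
pose i0 := SeqSub (in_s _ Aa0).
have [i _ i_min] := @arg_minP _ _ _ i0 xpredT (@ssval _ s) isT.
have [a Aa fa] : (f @` A) (ssval i) by rewrite sE; exact: ssvalP.
by exists a => // b Ab; rewrite fa; exact: (i_min (SeqSub (in_s _ Ab))).
Qed.

(** * Convexity and semispaces *)

Section Convexity.
Variables (R : realType) (d : nat).
Implicit Types (K H : set 'cV[R]_d) (v : 'cV[R]_d).

Lemma convex_bigcap (I : Type) (D : set I) (F : I -> set 'cV[R]_d) :
  (forall i, D i -> convex_subset (F i)) ->
  convex_subset (\bigcap_(i in D) F i).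
Proof.
move=> cF x y l; rewrite !inE => xF yF i Di.
by apply/set_mem/(cF i Di); rewrite inE; [exact: xF | exact: yF].
Qed.

Lemma convex_setI K H :
  convex_subset K -> convex_subset H -> convex_subset (K `&` H).
Proof.
move=> cK cH x y l; rewrite !inE => -[xK xH] [yK yH].
by split; apply/set_mem; [apply: cK | apply: cH]; rewrite inE.
Qed.

Definition halfspace v (c : R) : set 'cV[R]_d := [set x | c <= (v^T *m x) 0 0].

Lemma halfspace_le v (c c' : R) : c <= c' -> halfspace v c' `<=` halfspace v c.
Proof. by move=> cc' x; exact: le_trans. Qed.

Lemma convex_halfspace v (c : R) : convex_subset (halfspace v c).
Proof.
move=> x y l; rewrite !inE /halfspace /= => cx cy.
change (c <= (v^T *m (l%:num *: x + (1 - l%:num) *: y)) 0 0).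
rewrite mulmxDr -!scalemxAr [leRHS]mxE [X in _ <= X + _]mxE [X in _ <= _ + X]mxE.
rewrite -[leLHS]mul1r -[X in X * c](subrKC l%:num 1) mulrDl.
by rewrite lerD // ler_wpM2l // subr_ge0.
Qed.

End Convexity.

Section Colorful.
Variables (R : realType) (d : nat) (P : property R d).
Implicit Types (A C H M : set 'cV[R]_d).

(** * Cutting rainbow intersections by a semispace *)

(** Of the [h.+1] sets [K i] and [H], any selection of [h], with repetitions,
    misses one: either [H], or some [K j]. The two hypotheses cover these cases. *)
Lemma helly_cut (h : nat) (K : 'I_h -> set 'cV[R]_d) H :
  helly_at P h -> monotone_property P ->
  (forall i, convex_subset (K i)) -> convex_subset H ->
  P (\bigcap_i K i) ->
  (forall j, P (\bigcap_(i in [set~ j]) K i `&` H)) ->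
  P (\bigcap_i K i `&` H).
Proof.
move=> [_ hellyP] monoP cK cH PK PKH.
pose F (j : 'I_h.+1) := if unlift ord_max j is Some i then K i else H.
have Flift i : F (lift ord_max i) = K i by rewrite /F liftK.
have Fmax : F ord_max = H by rewrite /F unlift_none.
have cF j : convex_subset (F j) by rewrite /F; case: unlift.
have cKH (D : set 'I_h) : convex_subset (\bigcap_(i in D) K i `&` H).
  by apply: convex_setI => //; exact: convex_bigcap.
have -> : \bigcap_i K i `&` H = \bigcap_j F j.
  apply/seteqP; split=> [x [xK xH] j _|x xF].
    by rewrite /F; case: unlift => // i; exact: xK.
  split=> [i _|]; first by rewrite -Flift; exact: xF.
  by rewrite -Fmax; exact: xF.
apply: hellyP => // s.
have cFs : convex_subset (\bigcap_k F (s k)) by exact: convex_bigcap.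
have [j js] : exists j, j \notin codom s.
  apply/existsP; rewrite -negb_forall; apply/negP => /forallP all_s.
  have := leq_image_card s predT.
  by rewrite !(eq_card all_s) !card_ord ltnn.
have sN k : s k != j by apply: contraNneq js => <-; exact: codom_f.
case: (unliftP ord_max j) sN => [i ->|->] sN.
  apply: monoP (PKH i) => // x [xK xH] k _.
  rewrite /F; case: unliftP => // i' sk; apply: xK => /= i'i.
  by move: (sN k); rewrite sk i'i eqxx.
apply: monoP PK => //; first exact: convex_bigcap.
move=> x xK k _; rewrite /F; case: unliftP => [i _|sk]; first exact: xK.
by move: (sN k); rewrite sk eqxx.
Qed.

(** * Minimal sets *)

Definition minimal_semispace v K :=
  containment_minimal (fun H => semispace v H /\ P (K `&` H)).

Definition minimal_inside K :=
  containment_minimal (fun C => [/\ convex_subset C, C `<=` K & P C]).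

(** Semispaces of one direction are nested, and one that works for the smaller
    set [C] works for [A]. So [H'] inside [H] would contradict the minimality of
    [H], and [H] inside [H'] that of [H'], unless the two are equal. *)
Lemma minimal_semispace_subset v A C H H' :
  monotone_property P -> convex_subset A -> convex_subset C -> C `<=` A ->
  minimal_semispace v A H -> minimal_semispace v C H' -> P (C `&` H) ->
  H' = H.
Proof.
move=> monoP cA cC CA [[sH _] minH] [[sH' PCH'] minH'] PCH.
have [[c HE] [c' H'E]] := (sH, sH').
have [cc'|/ltW c'c] := leP c c'; last first.
  by apply/esym/minH' => //; rewrite HE H'E; exact: halfspace_le.
have cH' : convex_subset H' by rewrite H'E; exact: convex_halfspace.
apply: minH; last by rewrite HE H'E; exact: halfspace_le.
split=> //; apply: monoP PCH'; [exact: convex_setI..|exact: setSI].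
Qed.

(** A minimal set inside [C] is minimal inside [A], hence equal to [M]. Its
    existence must be assumed: [M] being the only minimal set inside [A] does not
    put [M] inside every convex subset of [A] with the property, since such a
    subset might contain no minimal one. *)
Lemma unique_minimal_subset A C M :
  C `<=` A -> unique (minimal_inside A) M ->
  (exists M', minimal_inside C M') -> M `<=` C.
Proof.
move=> CA [_ uM] [M' [[cM' M'C PM'] minM']].
rewrite (uM M') //; split=> [|B [cB BA PB] BM'].
  by split=> //; exact: subset_trans CA.
by apply: minM' => //; split=> //; exact: subset_trans M'C.
Qed.

(** * Colorability *)

Section Rainbow.
Variables (h : nat) (F : 'I_h -> set (set 'cV[R]_d)).

Definition rainbow : set ('I_h -> set 'cV[R]_d) :=
  [set K | forall i, F i (K i)].

Definition skip (j : 'I_h) (K : 'I_h -> set 'cV[R]_d) :=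
  \bigcap_(i in [set~ j]) K i.

Hypotheses (hellyP : helly_at P h) (monoP : monotone_property P).
Hypotheses (finF : forall i, finite_set (F i)).
Hypothesis cF : forall i K, F i K -> convex_subset K.
Hypothesis rainbowP : forall K, rainbow K -> P (\bigcap_i K i).

Lemma convex_rainbow K D : rainbow K -> convex_subset (\bigcap_(i in D) K i).
Proof. by move=> rK; apply: convex_bigcap => i _; exact: cF (rK i). Qed.

Lemma property_skip j K : rainbow K -> P (skip j K).
Proof.
move=> rK; apply: monoP (rainbowP rK); [exact: convex_rainbow..|].
by move=> x xK i _; exact: xK.
Qed.

(** The family on which orderability is used: partial intersections supply the
    largest semispace, full ones the minimal sets compared with [M]. *)
Definition rainbow_intersections : set (set 'cV[R]_d) :=
  [set skip p.1 p.2 | p in setT `*` rainbow] `|`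
  [set \bigcap_i K i | K in rainbow].

Lemma finite_rainbow_intersections : finite_set rainbow_intersections.
Proof.
have finK : finite_set rainbow by exact: finite_set_choices.
rewrite finite_setU; split; apply: finite_image => //.
exact: finite_setX.
Qed.

(** The bounds of the minimal semispaces are finitely many reals. Their least
    value gives a semispace [H] containing all the others, so cutting by [H]
    keeps the property by monotonicity. *)
Lemma rainbow_largest_semispace v :
  rainbow !=set0 ->
  (forall j K, rainbow K -> exists H, minimal_semispace v (skip j K) H) ->
  exists j K H, [/\ rainbow K, minimal_semispace v (skip j K) H &
    forall j' K', rainbow K' -> P (skip j' K' `&` H)].
Proof.
move=> [K0 rK0] exH.
have /choice[c cP] (p : 'I_h * ('I_h -> set 'cV[R]_d)) : exists c : R,
    rainbow p.2 -> minimal_semispace v (skip p.1 p.2) (halfspace v c).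
  have [rp|] := pselect (rainbow p.2); last by exists 0.
  have [H HP] := exH p.1 _ rp.
  by have [[[c HE] _] _] := HP; exists c => _; rewrite HE in HP.
have h_gt0 : (0 < h)%N by case: hellyP.
have [] := @finite_set_argmin _ _ _ (setT `*` rainbow) c.
- by apply: finite_setX => //; exact: finite_set_choices.
- by exists (Ordinal h_gt0, K0).
move=> [j K] [_ rK] c_min; exists j, K, (halfspace v (c (j, K))).
split=> [//||j' K' rK']; first exact: (cP (j, K)).
have [[_ PK'] _] := cP (j', K') rK'.
have cvx c0 : convex_subset (skip j' K' `&` halfspace v c0).
  by apply: convex_setI; [exact: convex_rainbow | exact: convex_halfspace].
apply: monoP PK' => //; apply: setIS; apply: halfspace_le.
exact: c_min (j', K') _.
Qed.

End Rainbow.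

Lemma helly_colorable (h : nat) :
  helly_at P h -> monotone_property P -> orderable P -> colorable h P.
Proof.
move=> hellyP monoP ordP F finF F0 ccF rainbowP.
have cF i K : F i K -> convex_subset K by move=> /ccF[].
have /choice[K0 rK0] := F0.
have [|v _ ordv] := ordP _ (finite_rainbow_intersections finF).
  by move=> _ [[[j K] [_ /= rK] <-]|[K rK <-]]; exact: (convex_rainbow cF rK).
have ord_skip j K (rK : rainbow F K) := ordv (skip j K)
  (or_introl (ex_intro2 _ _ (j, K) (conj I rK) erefl))
  (property_skip monoP cF rainbowP j rK).
have ord_full K (rK : rainbow F K) := ordv (\bigcap_i K i)
  (or_intror (ex_intro2 _ _ K rK erefl)) (rainbowP K rK).
have [||j [K [H [rK minH PcutH]]]] :=
    rainbow_largest_semispace (v := v) hellyP monoP finF cF.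
- by exists K0.
- by move=> j K rK; have [H ? _] := ord_skip j K rK; exists H.
have [H1 minH1 [M uM]] := ord_skip j K rK.
have cA : convex_subset (skip j K) by exact: (convex_rainbow cF rK).
have [[_ PskH] _] := minH.
have H1E : H1 = H by exact: minimal_semispace_subset minH minH1 PskH.
rewrite {}H1E in uM.
have [[cM MA PM] _] := uM.1.
have cH : convex_subset H.
  by have [[[c ->] _] _] := minH; exact: convex_halfspace.
exists j; apply: (monoP M) => //; first by apply: convex_bigcap => L /cF.
(* Completing the optimal partial choice by [L] gives a full rainbow choice. *)
move=> x Mx L FL; pose K' i := if i == j then L else K i.
have rK' : rainbow F K' by move=> i; rewrite /K'; case: eqP => [->|].
have KL : \bigcap_i K' i `<=` skip j K `&` L.
  move=> y yK'; split=> [i /eqP/negPf ij|].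
    by have := yK' i I; rewrite /K' ij.
  by have := yK' j I; rewrite /K' eqxx.
have cK' : convex_subset (\bigcap_i K' i) by exact: (convex_rainbow cF rK').
have PK'H : P (\bigcap_i K' i `&` H).
  apply: helly_cut => //.
  - by move=> i; exact: cF (rK' i).
  - exact: rainbowP.
  - by move=> i; exact: PcutH.
have [H2 minH2 [M' [minM' _]]] := ord_full K' rK'.
have H2E : H2 = H.
  by apply: minimal_semispace_subset minH minH2 PK'H => // y /KL[].
rewrite {}H2E in minM'.
have MK' : M `<=` \bigcap_i K' i `&` H.
  apply: unique_minimal_subset uM _; first by apply: setSI => y /KL[].
  by exists M'.
by have [/KL[]] := MK' x Mx.
Qed.

End Colorful.

Theorem theorem5p3 (R : realType) (d : nat) (P : property R d) :
  helly P -> monotone_property P -> orderable P ->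
  exists2 h : nat, helly_number P = Some h & colorable h P.
Proof.
move=> [h hE] monoP ordP; exists h => //.
by have [hellyP _] := (helly_numberP P h).1 hE; exact: helly_colorable.
Qed.
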